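(* There exists a consistent atomic RCC8 network over $\{\mathbf{DC},\mathbf{PO}\}$ which has no convex solution in $\mathbb{R}^2$, and there exists a consistent atomic RCC8 network over $\{\mathbf{EC},\mathbf{PO}\}$ which has no convex solution in $\mathbb{R}^2$.
   Context: A region in $\mathbb{R}^n$ ($n\geq 1$) is a nonempty regular closed subset $X$, i.e. $X=\mathrm{cl}(\mathrm{int}(X))$; write $i(X)$ for the interior. The eight RCC8 base relations between regions $a,b$ (jointly exhaustive and pairwise disjoint; $\subset$ denotes proper inclusion) are: $a\,\mathbf{EQ}\,b$: $a=b$; $a\,\mathbf{DC}\,b$: $a\cap b=\emptyset$; $a\,\mathbf{EC}\,b$: $a\cap b\neq\emptyset$ and $i(a)\cap i(b)=\emptyset$; $a\,\mathbf{PO}\,b$: $i(a)\cap i(b)\neq\emptyset$, $a\not\subseteq b$, $b\not\subseteq a$; $a\,\mathbf{TPP}\,b$: $a\subset b$ and $a\not\subset i(b)$; $a\,\mathbf{NTPP}\,b$: $a\subset i(b)$; and the converses $\mathbf{TPP}^{-1}$, $\mathbf{NTPP}^{-1}$ of the last two. Let $V$ be a finite set of variables. An RCC8 constraint is an expression $u\,R\,v$ with $u,v\in V$ and $R$ a nonempty set of base relations; an RCC8 network is a set of such constraints. It is atomic if for every pair of distinct variables $u,v$ it contains a constraint $u\,R\,v$ or $v\,R\,u$ with $R$ a singleton. It is a network over a set $\mathcal{R}$ of base relations if every constraint $u\,R\,v$ in it has $R\subseteq\mathcal{R}$. An $n$-dimensional solution (solution in $\mathbb{R}^n$) of a network is a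 map $\mathcal{S}$ from $V$ to regions of $\mathbb{R}^n$ such that for each constraint $u\,R\,v$ the base relation holding between $\mathcal{S}(u)$ and $\mathcal{S}(v)$ belongs to $R$. A network is consistent if it has a solution in $\mathbb{R}^n$ for some $n\geq 1$ (the regions need not be convex or connected). A solution is convex if every $\mathcal{S}(v)$ is a convex set. *)

(* Defs.v *)
From mathcomp Require Import all_boot all_order all_algebra.
From mathcomp Require Import all_classical all_reals all_analysis.

Set Implicit Arguments.
Unset Strict Implicit.
Unset Printing Implicit Defensive.

Import Order.TTheory GRing.Theory Num.Theory numFieldNormedType.Exports.
Local Open Scope classical_set_scope.
Local Open Scope ring_scope.

Inductive rcc8 := EQ | DC | EC | PO | TPP | NTPP | TPPi | NTPPi.

Definition region (T : topologicalType) (X : set T) : Prop :=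
  X !=set0 /\ regclosed X.

(* `<` on sets is proper inclusion.  In particular a `<` interior b excludes
   a = interior b; for regions of R^n this only matters when a = b = setT,
   where it is what keeps NTPP disjoint from EQ. *)
Definition rcc8_holds (T : topologicalType) (r : rcc8) (a b : set T) : Prop :=
  match r with
  | EQ => a = b
  | DC => a `&` b = set0
  | EC => a `&` b !=set0 /\ interior a `&` interior b = set0
  | PO => [/\ interior a `&` interior b !=set0, ~ a `<=` b & ~ b `<=` a]
  | TPP => a `<` b /\ ~ a `<` interior b
  | NTPP => a `<` interior b
  | TPPi => b `<` a /\ ~ b `<` interior a
  | NTPPi => b `<` interior a
  end.

Record constraint (V : Type) := Constraint {
  clhs : V;
  crel : set rcc8;
  crhs : V;
  crel_nonempty : crel !=set0 }.

Definition network (V : Type) := set (constraint V).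

Definition atomic (V : Type) (N : network V) : Prop :=
  forall u v : V, u <> v ->
  exists c, [/\ N c, (exists r, crel c = [set r]) &
    (clhs c = u /\ crhs c = v) \/ (clhs c = v /\ crhs c = u)].

Definition network_over (V : Type) (N : network V) (B : set rcc8) : Prop :=
  forall c, N c -> crel c `<=` B.

(* The base relations are pairwise disjoint and jointly exhaustive on regions of
   R^n, so the base relation holding between two regions belongs to a set exactly
   when some member of that set holds between them. *)
Definition solution (R : realType) (V : Type) (N : network V) (n : nat)
    (S : V -> set 'rV[R]_n) : Prop :=
  (forall v, region (S v)) /\
  (forall c, N c ->
    exists2 r, crel c r & rcc8_holds r (S (clhs c)) (S (crhs c))).

Definition consistent (R : realType) (V : Type) (N : network V) : Prop :=
  exists n : nat, (0 < n)%N /\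
  exists S : V -> set 'rV[R]_n, solution N S.

Definition convex_solution (R : realType) (V : Type) (N : network V) (n : nat)
    (S : V -> set 'rV[R]_n) : Prop :=
  solution N S /\ forall v, convex_set (S v : set (convex_lmodType 'rV[R]_n)).

(* Main.v *)
Require Import Defs.
From mathcomp Require Import all_boot all_order all_algebra.
From mathcomp Require Import all_classical all_reals all_analysis.
From mathcomp Require Import zify ring lra.

(* Both networks come from the same bipartite graph: vertices [e_i], for i in a
   27-element set, and two copies of a vertex [d_S] for every set S of indices,
   with [e_i] adjacent to [d_S] when i is in S; edges are labelled PO and
   non-edges DC or EC.  Any such network is realised on the line by finite unions
   of unit intervals.

   Interiors of the regions of a convex solution in the plane would be convex
   sets intersecting exactly along the edges of the graph.  A line separates the
   two disjoint sets [d_S] with S full; every [e_i] meets both, hence crosses the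
   line, at pairwise distinct points which we number 0, ..., 26 along the line.
   Consider the nine disjoint triples {k, 9 + k, 18 + k}.  By pigeonhole, for two
   of them, say for k < k', the points chosen in [d_T] and [e_i] lie on the same
   sides of the line, and among the three positions two have the same side.  This
   gives, in one half-plane, an arc from e_(9p+k) to e_(9q+k) and a disjoint arc
   from e_(9p+k') to e_(9q+k') whose endpoints on the line interleave, which is
   impossible. *)

Set Implicit Arguments.
Unset Strict Implicit.
Unset Printing Implicit Defensive.

Import Order.TTheory GRing.Theory Num.Theory numFieldNormedType.Exports.
Local Open Scope ring_scope.
Local Open Scope classical_set_scope.

(** * Convex sets in the plane *)

Section Plane.
Variable R : realFieldType.
Implicit Types X Y : R -> R -> Prop.

Definition pconvex X := forall x y x' y' t, 0 <= t <= 1 -> X x y -> X x' y' ->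
  X ((1 - t) * x + t * x') ((1 - t) * y + t * y').

Definition apart X Y := forall x y, X x y -> Y x y -> False.

Definition below X Y := forall x y y', X x y -> Y x y' -> y < y'.

Lemma apart_sym X Y : apart X Y -> apart Y X.
Proof. by move=> h x y hY hX; exact: (h x y). Qed.

(* If the order changed from one abscissa to another, the chords joining the
   two pairs of points would cross. *)
Lemma apart_below X Y x y y' : pconvex X -> pconvex Y -> apart X Y ->
  X x y -> Y x y' -> y < y' -> below X Y.
Proof.
move=> cX cY XY Xy Yy' yy' x1 y1 y1' Xy1 Yy1'; rewrite ltNge; apply/negP => le1.
pose d := (y' - y) + (y1 - y1').
have d0 : 0 < d by rewrite /d; lra.
pose t := (y' - y) / d.
have t01 : 0 <= t <= 1.
  apply/andP; split; first by rewrite /t divr_ge0 //; lra.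
  by rewrite /t ler_pdivrMr // /d; lra.
apply: (XY _ _ (cX _ _ _ _ t t01 Xy Xy1)).
have -> : (1 - t) * y + t * y1 = (1 - t) * y' + t * y1'.
  rewrite /t; have : d != 0 by rewrite gt_eqF.
  rewrite /d => dn0; field; exact: dn0.
exact: cY.
Qed.

Lemma pconvex_slice X x0 y0 x1 y1 x : pconvex X -> X x0 y0 -> X x1 y1 ->
  x0 <= x <= x1 -> exists y, X x y.
Proof.
move=> cX h0 h1 /andP[x0x xx1].
have [x01|x01] := eqVneq x0 x1; first by exists y0; have -> : x = x0 by lra.
have d0 : 0 < x1 - x0 by move: x01; rewrite neq_lt => /orP[]; lra.
pose t := (x - x0) / (x1 - x0).
exists ((1 - t) * y0 + t * y1).
have {1}-> : x = (1 - t) * x0 + t * x1.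
  by rewrite /t; field; rewrite gt_eqF.
apply: cX => //; apply/andP; split; first by rewrite /t divr_ge0 //; lra.
by rewrite /t ler_pdivrMr //; lra.
Qed.

(** * Interleaved arcs in a half-plane *)

Section Interleave.
(** The arcs: [D] joins [E1] to [E3], and [D'] joins [E2] to [E4]. The meeting point on each [Ei]
    has abscissa [ri], so by convexity [Ei] meets every vertical line between the axis and [ri]. *)
Variables (E1 E2 E3 E4 D D' : R -> R -> Prop).
Hypotheses (cE1 : pconvex E1) (cE2 : pconvex E2) (cE3 : pconvex E3)
  (cE4 : pconvex E4) (cD : pconvex D) (cD' : pconvex D').
Hypotheses (b12 : below E1 E2) (b23 : below E2 E3) (b34 : below E3 E4).
Hypotheses (DD' : apart D D') (DE2 : apart D E2) (DE4 : apart D E4)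
  (D'E1 : apart D' E1) (D'E3 : apart D' E3).
Variables (a1 a2 a3 a4 : R).
Hypotheses (A1 : E1 0 a1) (A2 : E2 0 a2) (A3 : E3 0 a3) (A4 : E4 0 a4).
Variables (r1 r2 r3 r4 y1 y2 y3 y4 : R).
Hypotheses (p1 : 0 <= r1) (p2 : 0 <= r2) (p3 : 0 <= r3) (p4 : 0 <= r4).
Hypotheses (U1 : E1 r1 y1) (V1 : D r1 y1) (U3 : E3 r3 y3) (V3 : D r3 y3)
  (U2 : E2 r2 y2) (V2 : D' r2 y2) (U4 : E4 r4 y4) (V4 : D' r4 y4).

(** [E2] passes above the point of [D] at [r1], so [D] stays below [E2] and can meet [E3] only
    beyond [r2]. Comparing at [r2] then puts [D] below [D'] and [D'] below [E3]. If [r3 <= r4], this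
    is absurd at [r3], where [D] meets [E3]; otherwise at [r4], where [D'] meets [E4]. *)
Lemma interleave_inner : r1 <= r2 -> False.
Proof using All.
move=> r12.
have [z2 Z2] := pconvex_slice cE2 A2 U2 (introT andP (conj p1 r12)).
have bDE2 : below D E2 by apply: (apart_below cD cE2 DE2 V1 Z2); exact: b12 U1 Z2.
have r23 : r2 < r3.
  rewrite ltNge; apply/negP => r32.
  have [z Z] := pconvex_slice cE2 A2 U2 (introT andP (conj p3 r32)).
  by have := lt_trans (bDE2 _ _ _ V3 Z) (b23 Z U3); rewrite ltxx.
have [w W] := pconvex_slice cD V1 V3 (introT andP (conj r12 (ltW r23))).
have bDD' : below D D' by apply: (apart_below cD cD' DD' W V2); exact: bDE2 W U2.
have [z3 Z3] := pconvex_slice cE3 A3 U3 (introT andP (conj p2 (ltW r23))).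
have bD'E3 : below D' E3.
  by apply: (apart_below cD' cE3 D'E3 V2 Z3); exact: b23 U2 Z3.
have [r34|r43] := leP r3 r4.
  have [z Z] := pconvex_slice cD' V2 V4 (introT andP (conj (ltW r23) r34)).
  by have := lt_trans (bDD' _ _ _ V3 Z) (bD'E3 _ _ _ Z U3); rewrite ltxx.
have [z Z] := pconvex_slice cE3 A3 U3 (introT andP (conj p4 (ltW r43))).
by have := lt_trans (bD'E3 _ _ _ V4 Z) (b34 Z U4); rewrite ltxx.
Qed.

(** Comparing at [r2] puts [E1] below [D'] and [D'] below [E3]; comparing at [r3] puts [D'] below
    [D]. If [r1 <= r4], then [D'] runs strictly between [E1] and [D] at [r1], where they meet;
    otherwise [D] runs strictly between [D'] and [E4] at [r4]. *)
Lemma interleave_outer : r2 < r1 -> r2 <= r3 -> r3 < r4 -> False.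
Proof using All.
move=> r21 r23 r34.
have [z1 Z1] := pconvex_slice cE1 A1 U1 (introT andP (conj p2 (ltW r21))).
have [z3 Z3] := pconvex_slice cE3 A3 U3 (introT andP (conj p2 r23)).
have [w W] := pconvex_slice cD' V2 V4 (introT andP (conj r23 (ltW r34))).
have bE1D' : below E1 D'.
  by apply: (apart_below cE1 cD' (apart_sym D'E1) Z1 V2); exact: b12 Z1 U2.
have bD'E3 : below D' E3.
  by apply: (apart_below cD' cE3 D'E3 V2 Z3); exact: b23 U2 Z3.
have bD'D : below D' D.
  by apply: (apart_below cD' cD (apart_sym DD') W V3); exact: bD'E3 W U3.
have [r14|r41] := leP r1 r4.
  have [z Z] := pconvex_slice cD' V2 V4 (introT andP (conj (ltW r21) r14)).
  by have := lt_trans (bE1D' _ _ _ U1 Z) (bD'D _ _ _ Z V1); rewrite ltxx.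
have [z Z] := pconvex_slice cE4 A4 U4 (introT andP (conj p3 (ltW r34))).
have bDE4 : below D E4.
  by apply: (apart_below cD cE4 DE4 V3 Z); exact: b34 U3 Z.
have [v V] := pconvex_slice cD V3 V1 (introT andP (conj (ltW r34) (ltW r41))).
by have := lt_trans (bD'D _ _ _ V4 V) (bDE4 _ _ _ V U4); rewrite ltxx.
Qed.

End Interleave.

Lemma pconvex_flip X : pconvex X -> pconvex (fun x y => X x (- y)).
Proof.
move=> cX x y x' y' t t01 h h'.
have -> : - ((1 - t) * y + t * y') = (1 - t) * - y + t * - y' by ring.
exact: cX.
Qed.

Lemma pconvex_mirror X : pconvex X -> pconvex (fun x y => X (- x) y).
Proof.
move=> cX x y x' y' t t01 h h'.
have -> : - ((1 - t) * x + t * x') = (1 - t) * - x + t * - x' by ring.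
exact: cX.
Qed.

Lemma below_flip X Y : below X Y -> below (fun x y => Y x (- y)) (fun x y => X x (- y)).
Proof. by move=> b x y y' hY hX; have := b _ _ _ hX hY; rewrite ltrN2. Qed.

Lemma interleave E1 E2 E3 E4 D D' a1 a2 a3 a4 r1 r2 r3 r4 y1 y2 y3 y4 :
  pconvex E1 -> pconvex E2 -> pconvex E3 -> pconvex E4 -> pconvex D -> pconvex D' ->
  apart E1 E2 -> apart E2 E3 -> apart E3 E4 ->
  apart D D' -> apart D E2 -> apart D E4 -> apart D' E1 -> apart D' E3 ->
  E1 0 a1 -> E2 0 a2 -> E3 0 a3 -> E4 0 a4 -> a1 < a2 -> a2 < a3 -> a3 < a4 ->
  0 <= r1 -> 0 <= r2 -> 0 <= r3 -> 0 <= r4 ->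
  E1 r1 y1 -> D r1 y1 -> E3 r3 y3 -> D r3 y3 ->
  E2 r2 y2 -> D' r2 y2 -> E4 r4 y4 -> D' r4 y4 -> False.
Proof.
move=> cE1 cE2 cE3 cE4 cD cD' n12 n23 n34 DD' DE2 DE4 D'E1 D'E3 A1 A2 A3 A4.
move=> a12 a23 a34 p1 p2 p3 p4 U1 V1 U3 V3 U2 V2 U4 V4.
have b12 := apart_below cE1 cE2 n12 A1 A2 a12.
have b23 := apart_below cE2 cE3 n23 A2 A3 a23.
have b34 := apart_below cE3 cE4 n34 A3 A4 a34.
(* Reversing the vertical order exchanges the two arcs. *)
pose flip (X : R -> R -> Prop) x y := X x (- y).
have fl X x y : X x y -> flip X x (- y) by rewrite /flip opprK.
have ap X Y : apart X Y -> apart (flip X) (flip Y) by move=> h x y; exact: h.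
have inner : r4 <= r3 -> False.
  apply: (@interleave_inner (flip E4) (flip E3) (flip E2) (flip E1) (flip D') (flip D)
    _ _ _ _ _ _ _ _ _ _ _ _ _ _ (- a4) (- a3) (- a2) (- a1) _ _ _ _ r4 r3 r2 r1
    (- y4) (- y3) (- y2) (- y1));
  by [exact: pconvex_flip | exact: below_flip | apply: ap; do ?exact: apart_sym
     | exact: fl | by []].
have outer : r3 < r4 -> r3 <= r2 -> r2 < r1 -> False.
  apply: (@interleave_outer (flip E4) (flip E3) (flip E2) (flip E1) (flip D') (flip D)
    _ _ _ _ _ _ _ _ _ _ _ _ _ _ (- a4) (- a3) (- a2) (- a1) _ _ _ _ r4 r3 r2 r1
    (- y4) (- y3) (- y2) (- y1));
  by [exact: pconvex_flip | exact: below_flip | apply: ap; do ?exact: apart_sym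
     | exact: fl | by []].
(* The flip exchanges [r1] with [r4] and [r2] with [r3]. Outside the inner case and its flip,
   [r2 < r1] and [r3 < r4], and the order of [r2] and [r3] decides between the outer case and its
   flip. *)
have [r12|r21] := leP r1 r2.
  by apply: (@interleave_inner E1 E2 E3 E4 D D' _ _ _ _ _ _ _ _ _ _ _ _ _ _
    a1 a2 a3 a4 _ _ _ _ r1 r2 r3 r4 y1 y2 y3 y4).
have [r43|r34] := leP r4 r3; first exact: inner.
have [r23|r32] := leP r2 r3; last exact: outer (ltW r32) _.
by apply: (@interleave_outer E1 E2 E3 E4 D D' _ _ _ _ _ _ _ _ _ _ _ _ _ _
    a1 a2 a3 a4 _ _ _ _ r1 r2 r3 r4 y1 y2 y3 y4).
Qed.

(** * Crossings of a line and the pigeonhole argument *)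

Lemma pigeonhole (aT rT : finType) (f : aT -> rT) :
  (#|rT| < #|aT|)%N -> exists x y, x != y /\ f x = f y.
Proof.
move=> lt; have /injectivePn[x [y xy fxy]] : ~~ injectiveb f.
  by apply/injectiveP => /leq_card; rewrite leqNgt lt.
by exists x, y.
Qed.

Lemma pigeonhole_ord n (rT : finType) (f : 'I_n -> rT) :
  (#|rT| < n)%N -> exists x y : 'I_n, (x < y)%N /\ f x = f y.
Proof.
move=> lt; have [|x [y [xy fxy]]] := @pigeonhole _ _ f; first by rewrite card_ord.
by case: (ltngtP x y) xy => [xy _|yx _|/val_inj->]; [exists x, y | exists y, x
  | rewrite eqxx].
Qed.

(** The boolean tells apart the two copies of each [d_S]. Both copies of the full set serve to find
    the separating line; the arcs use only the copies marked [true]. *)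
Definition drawing (E : 'I_27 -> R -> R -> Prop)
    (D : bool * {set 'I_27} -> R -> R -> Prop) :=
  [/\ (forall i, pconvex (E i)), (forall d, pconvex (D d)),
      (forall i j, i != j -> apart (E i) (E j)),
      (forall d d' : bool * {set 'I_27}, d != d' -> apart (D d) (D d')) &
      (forall i (d : bool * {set 'I_27}), if i \in d.2 then exists x y, E i x y /\ D d x y
                   else apart (E i) (D d))].

Lemma no_sorted_drawing (E : 'I_27 -> R -> R -> Prop)
    (D : bool * {set 'I_27} -> R -> R -> Prop) (a : 'I_27 -> R) : drawing E D ->
  (forall i, E i 0 (a i)) -> (forall i j : 'I_27, (i < j)%N -> a i < a j) -> False.
Proof.
move=> [cE cD aE aD aED] Ea a_lt.
pose pos (p : 'I_3) (k : 'I_9) : 'I_27 := inord (9 * p + k).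
have posE p k : pos p k = (9 * p + k)%N :> nat.
  by rewrite inordK //; have := ltn_ord p; have := ltn_ord k; lia.
pose T k := [set pos p k | p : 'I_3].
have inT p k : pos p k \in T k by apply/imsetP; exists p.
have posT p k k' : k != k' -> pos p k \notin T k'.
  move=> kk'; apply/imsetP => -[p' _ /(congr1 val)/=]; rewrite !posE => h.
  by case/negP: kk'; apply/eqP/val_inj => /=; move: h;
     have := ltn_ord k; have := ltn_ord k'; lia.
have /fin_all_exists[c cP] (pk : 'I_3 * 'I_9) : exists z : R * R,
    E (pos pk.1 pk.2) z.1 z.2 /\ D (true, T pk.2) z.1 z.2.
  have := aED (pos pk.1 pk.2) (true, T pk.2); rewrite /= inT => -[x [y h]].
  by exists (x, y).
(* The colour of a triple records the sides of its three meeting points: 8 colours for 9 triples. *)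
pose col k := [ffun p : 'I_3 => 0 <= (c (p, k)).1].
have [|k [k' [kk' colE]]] := @pigeonhole_ord 9 _ col.
  by rewrite card_ffun card_bool card_ord.
have [|p [q [pq sideE]]] := @pigeonhole_ord 3 _ (col k).
  by rewrite card_bool.
have nkk' : k != k' by rewrite neq_ltn kk'.
have nk'k : k' != k by rewrite eq_sym.
have npos (p1 p2 : 'I_3) (k1 k2 : 'I_9) : (9 * p1 + k1 < 9 * p2 + k2)%N ->
    pos p1 k1 != pos p2 k2.
  by move=> lt; rewrite -val_eqE neq_ltn /= !posE lt.
have l12 : (9 * p + k < 9 * p + k')%N by lia.
have l23 : (9 * p + k' < 9 * q + k)%N.
  by have := ltn_ord k; have := ltn_ord k'; lia.
have l34 : (9 * q + k < 9 * q + k')%N by lia.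
have aDD : apart (D (true, T k)) (D (true, T k')).
  apply: aD; apply/eqP => -[TT]; case/negP: (posT p k k' nkk').
  by rewrite -TT inT.
have aDE p1 k1 k2 : k1 != k2 -> apart (D (true, T k2)) (E (pos p1 k1)).
  move=> n; apply: apart_sym; have := aED (pos p1 k1) (true, T k2).
  by rewrite /= (negPf (posT _ _ _ n)).
have lta (p1 p2 : 'I_3) (k1 k2 : 'I_9) : (9 * p1 + k1 < 9 * p2 + k2)%N ->
    a (pos p1 k1) < a (pos p2 k2).
  by move=> lt; apply: a_lt; rewrite !posE.
have sq : col k q = col k p by rewrite sideE.
have sp' : col k' p = col k p by rewrite colE.
have sq' : col k' q = col k p by rewrite -colE sq.
move: sq sp' sq'; rewrite !ffunE.
have [x0|x0] := leP 0 (c (p, k)).1 => sq sp' sq'.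
  have [[U1 V1] [U2 V2] [U3 V3] [U4 V4]] :=
    And4 (cP (p, k)) (cP (p, k')) (cP (q, k)) (cP (q, k')).
  exact: (interleave (cE _) (cE _) (cE _) (cE _) (cD _) (cD _)
    (aE _ _ (npos _ _ _ _ l12)) (aE _ _ (npos _ _ _ _ l23)) (aE _ _ (npos _ _ _ _ l34))
    aDD (aDE _ _ _ nk'k) (aDE _ _ _ nk'k) (aDE _ _ _ nkk') (aDE _ _ _ nkk')
    (Ea _) (Ea _) (Ea _) (Ea _) (lta _ _ _ _ l12) (lta _ _ _ _ l23) (lta _ _ _ _ l34)
    x0 sp' sq sq' U1 V1 U3 V3 U2 V2 U4 V4).
(* All four meeting points lie on the negative side; the reflection [x -> - x] fixes the axis and
   moves them to the positive one. *)
pose mir (X : R -> R -> Prop) x y := X (- x) y.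
have mi X x y : X x y -> mir X (- x) y by rewrite /mir opprK.
have mi0 X y : X 0 y -> mir X 0 y by rewrite /mir oppr0.
have ma X Y : apart X Y -> apart (mir X) (mir Y) by move=> h x y; exact: h.
have [[U1 V1] [U2 V2] [U3 V3] [U4 V4]] :=
  And4 (cP (p, k)) (cP (p, k')) (cP (q, k)) (cP (q, k')).
have neg (x : R) : (0 <= x) = false -> 0 <= - x.
  by rewrite leNgt oppr_ge0 => /negbFE/ltW.
exact: (interleave (pconvex_mirror (cE _)) (pconvex_mirror (cE _))
  (pconvex_mirror (cE _)) (pconvex_mirror (cE _)) (pconvex_mirror (cD _))
  (pconvex_mirror (cD _))
  (ma _ _ (aE _ _ (npos _ _ _ _ l12))) (ma _ _ (aE _ _ (npos _ _ _ _ l23)))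
  (ma _ _ (aE _ _ (npos _ _ _ _ l34)))
  (ma _ _ aDD) (ma _ _ (aDE _ _ _ nk'k)) (ma _ _ (aDE _ _ _ nk'k))
  (ma _ _ (aDE _ _ _ nkk')) (ma _ _ (aDE _ _ _ nkk'))
  (mi0 _ _ (Ea _)) (mi0 _ _ (Ea _)) (mi0 _ _ (Ea _)) (mi0 _ _ (Ea _))
  (lta _ _ _ _ l12) (lta _ _ _ _ l23) (lta _ _ _ _ l34)
  (neg _ (lt_geF x0)) (neg _ sp') (neg _ sq) (neg _ sq')
  (mi _ _ _ U1) (mi _ _ _ V1) (mi _ _ _ U3) (mi _ _ _ V3)
  (mi _ _ _ U2) (mi _ _ _ V2) (mi _ _ _ U4) (mi _ _ _ V4)).
Qed.

(** Disjointness makes the heights [a i] distinct, so the indices can be renumbered by height. Every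
    subset of indices has its vertices, so renumbering turns a drawing into a drawing. *)
Lemma no_crossed_drawing (E : 'I_27 -> R -> R -> Prop)
    (D : bool * {set 'I_27} -> R -> R -> Prop) (a : 'I_27 -> R) : drawing E D ->
  (forall i, E i 0 (a i)) -> False.
Proof.
move=> [cE cD aE aD aED] Ea.
have a_inj : injective a.
  move=> i j aij; apply/eqP; apply/negPn/negP => ij.
  by apply: (aE _ _ ij 0 (a i)); rewrite // aij.
pose s := sort (fun i j => a i <= a j) (enum 'I_27).
have ss : size s = 27 by rewrite size_sort size_enum_ord.
have us : uniq s by rewrite sort_uniq enum_uniq.
pose f (i : 'I_27) := nth ord0 s i.
have f_inj : injective f.
  by move=> i j /eqP; rewrite nth_uniq ?ss // => /eqP/val_inj.
apply: (@no_sorted_drawing (E \o f) (fun d => D (d.1, f @: d.2)) (a \o f)).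
- split=> [i|d|i j ij|[b S] [b' S'] dd'|i [b S]] /=; first exact: cE.
  + exact: cD.
  + by apply: aE; rewrite (inj_eq f_inj).
  + apply: aD; apply: contra_neq dd' => -[-> SS'].
    by congr pair; apply: (imset_inj f_inj).
  + by have := aED (f i) (b, f @: S); rewrite /= mem_imset.
- by move=> i; exact: Ea.
- move=> i j ij /=; rewrite lt_neqAle; apply/andP; split.
    by rewrite (inj_eq a_inj) (inj_eq f_inj) -val_eqE neq_ltn ij.
  apply: (sorted_leq_nth (leT := fun i j => a i <= a j)); rewrite ?inE ?ss //.
  + by move=> x y z; exact: le_trans.
  + by apply: sort_sorted => x y; exact: le_total.
  + exact: ltnW.
Qed.

(** * Separation by a line *)

Definition det2 (u v : R * R) := u.1 * v.2 - u.2 * v.1.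

(** The combination is normalised by [a + b + c] and built from two segments, first from [w] to [u],
    then to [v]; [0 < c] keeps both denominators positive. *)
Lemma pconvex_comb3 X (u v w : R * R) a b c : pconvex X ->
  X u.1 u.2 -> X v.1 v.2 -> X w.1 w.2 -> 0 <= a -> 0 <= b -> 0 < c ->
  a * u.1 + b * v.1 + c * w.1 = 0 -> a * u.2 + b * v.2 + c * w.2 = 0 -> X 0 0.
Proof.
move=> cX Xu Xv Xw a0 b0 c0 e1 e2.
have ac : 0 < a + c by lra.
have abc : 0 < a + b + c by lra.
have t1 : 0 <= a / (a + c) <= 1.
  by apply/andP; split; [rewrite divr_ge0 //; lra | rewrite ler_pdivrMr //; lra].
have t2 : 0 <= b / (a + b + c) <= 1.
  by apply/andP; split; [rewrite divr_ge0 //; lra | rewrite ler_pdivrMr //; lra].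
have := cX _ _ _ _ _ t2 (cX _ _ _ _ _ t1 Xw Xu) Xv.
have n1 : a + c != 0 by rewrite gt_eqF.
have n2 : a + b + c != 0 by rewrite gt_eqF.
have comb0 p q r : a * p + b * q + c * r = 0 ->
    (1 - b / (a + b + c)) * ((1 - a / (a + c)) * r + a / (a + c) * p)
      + b / (a + b + c) * q = 0.
  move=> e0; transitivity ((a * p + b * q + c * r) / (a + b + c)).
    by field; rewrite n1 n2.
  by rewrite e0 mul0r.
by rewrite !comb0.
Qed.

(** Seen from the origin, the points span an angle smaller than a half turn, so one of them is the
    most clockwise. *)
Lemma angular_min X (s : seq (R * R)) : pconvex X -> ~ X 0 0 ->
  (forall u, u \in s -> X u.1 u.2) -> s != [::] ->
  exists2 u, u \in s & forall v, v \in s -> 0 <= det2 u v.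
Proof.
move=> cX X0; elim: s => // w s IH Xs _.
have [->|s0] := eqVneq s [::].
  by exists w; rewrite ?mem_head // => v; rewrite inE => /eqP->; rewrite /det2; nra.
have [|u us umin] := IH _ s0; first by move=> u us; apply: Xs; rewrite inE us orbT.
have [uw|wu] := leP 0 (det2 u w).
  exists u; first by rewrite inE us orbT.
  by move=> v; rewrite inE => /orP[/eqP->|/umin].
exists w; first exact: mem_head.
move=> v; rewrite inE => /orP[/eqP->|vs]; first by rewrite /det2; nra.
rewrite leNgt; apply/negP => wv; case: X0.
(* Cramer: [det(u,v) w + det(w,u) v + det(v,w) u = 0]. *)
apply: (@pconvex_comb3 X w v u (det2 u v) (det2 w u) (det2 v w) cX).
- by apply: Xs; rewrite mem_head.
- by apply: Xs; rewrite inE vs orbT.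
- by apply: Xs; rewrite inE us orbT.
- exact: umin.
- by move: wu; rewrite /det2; lra.
- by move: wv; rewrite /det2; lra.
- by rewrite /det2; ring.
- by rewrite /det2; ring.
Qed.

Lemma no_drawing (E : 'I_27 -> R -> R -> Prop)
    (D : bool * {set 'I_27} -> R -> R -> Prop) : ~ drawing E D.
Proof.
move=> ED; have [cE cD aE aD aED] := ED.
have full b (i : 'I_27) : exists z : R * R, E i z.1 z.2 /\ D (b, finset.setT) z.1 z.2.
  by have := aED i (b, finset.setT); rewrite /= finset.in_setT => -[x [y h]];
    exists (x, y).
have [p pP] := fin_all_exists (full true).
have [q qP] := fin_all_exists (full false).
(* The set of differences of the two full sets is convex and, by their disjointness, misses the
   origin. *)
pose C x y := exists u v : R * R, [/\ D (true, finset.setT) u.1 u.2,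
  D (false, finset.setT) v.1 v.2, x = u.1 - v.1 & y = u.2 - v.2].
have cC : pconvex C.
  move=> _ _ _ _ t t01 [u [v [Du Dv -> ->]]] [u' [v' [Du' Dv' -> ->]]].
  exists ((1 - t) * u.1 + t * u'.1, (1 - t) * u.2 + t * u'.2),
    ((1 - t) * v.1 + t * v'.1, (1 - t) * v.2 + t * v'.2).
  by split; [exact: cD | exact: cD | rewrite /=; ring | rewrite /=; ring].
have C0 : ~ C 0 0.
  move=> [[u1 u2] [[v1 v2] /= [Du Dv /esym/subr0_eq e1 /esym/subr0_eq e2]]].
  by rewrite e1 e2 in Du; apply: (aD (true, finset.setT) (false, finset.setT)) Du Dv.
pose s := [seq (p ij.1 - q ij.2 : R * R) | ij : 'I_27 * 'I_27].
have sP i j : p i - q j \in s by apply/fintype.imageP; exists (i, j).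
have [||u us umin] := @angular_min C s cC C0.
- move=> _ /fintype.imageP[[i j] _ ->]; exists (p i), (q j).
  by split=> //; [case: (pP i) | case: (qP j)].
- by apply/eqP => s0; have := sP ord0 ord0; rewrite s0.
pose n := u.1 ^+ 2 + u.2 ^+ 2.
have n0 : n != 0.
  rewrite /n; apply/eqP => n0; apply: C0.
  have u1 : u.1 = 0 by nra.
  have u2 : u.2 = 0 by nra.
  have /fintype.imageP[[i j] _ uE] := us.
  exists (p i), (q j); rewrite uE /= in u1 u2.
  by split; [case: (pP i) | case: (qP j) | rewrite u1 | rewrite u2].
(* The direction [u] need only separate the 27 points [p i] from the 27 points [q j], not the whole
   sets. *)
have sep i j : det2 u (q j) <= det2 u (p i).
  by have := umin _ (sP i j); rewrite /det2 /=; lra.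
pose c := \big[Num.max/det2 u (q ord0)]_j det2 u (q j).
have qc j : det2 u (q j) <= c by rewrite /c; exact: le_bigmax.
have cp i : c <= det2 u (p i).
  by rewrite /c; apply/bigmax_leP; split=> [|j _]; exact: sep.
(* Coordinates in which the separating line [det2 u z = c] is the second axis. *)
pose fx s t := (u.1 * t - u.2 * (s + c)) / n.
pose fy s t := (u.2 * t + u.1 * (s + c)) / n.
pose tr (X : R -> R -> Prop) s t := X (fx s t) (fy s t).
have trE X x y : X x y -> tr X (u.1 * y - u.2 * x - c) (u.1 * x + u.2 * y).
  rewrite /tr.
  have -> : fx (u.1 * y - u.2 * x - c) (u.1 * x + u.2 * y) = x.
    by rewrite /fx; move: n0; rewrite /n => n0; field.
  have -> : fy (u.1 * y - u.2 * x - c) (u.1 * x + u.2 * y) = y.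
    by rewrite /fy; move: n0; rewrite /n => n0; field.
  by [].
have tr_convex X : pconvex X -> pconvex (tr X).
  move=> cX x y x' y' t t01 h h'; rewrite /tr.
  have -> : fx ((1 - t) * x + t * x') ((1 - t) * y + t * y') =
      (1 - t) * fx x y + t * fx x' y' by rewrite /fx; field.
  have -> : fy ((1 - t) * x + t * x') ((1 - t) * y + t * y') =
      (1 - t) * fy x y + t * fy x' y' by rewrite /fy; field.
  exact: cX.
have tr_apart X Y : apart X Y -> apart (tr X) (tr Y) by move=> h x y; exact: h.
(* [E i] contains [q i] and [p i], which lie weakly on opposite sides of the line. *)
have /fin_all_exists[a aP] i : exists y, tr (E i) 0 y.
  have [qE _] := qP i; have [pE _] := pP i.
  apply: (pconvex_slice (tr_convex _ (cE i)) (trE _ _ _ qE) (trE _ _ _ pE)).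
  by have := qc i; have := cp i; rewrite /det2; lra.
apply: (@no_crossed_drawing (tr \o E) (tr \o D) a) => //.
split=> [i|d|i j ij|d d' dd'|i d] /=.
- exact: tr_convex.
- exact: tr_convex.
- exact/tr_apart/aE.
- exact/tr_apart/aD.
- have := aED i d; case: ifP => _; last exact: tr_apart.
  by move=> [x [y [Ex Dx]]]; exists (u.1 * y - u.2 * x - c), (u.1 * x + u.2 * y);
    split; exact: trE.
Qed.

End Plane.

(** * Networks of graphs *)

(** Loops are excluded because none of [DC], [EC], [PO] holds between a region and itself. *)
Definition graph_network (V : eqType) (adj : rel V) (r0 : rcc8) : network V :=
  [set c | clhs c <> crhs c /\
           crel c = [set if adj (clhs c) (crhs c) then PO else r0]].

Lemma graph_network_atomic (V : eqType) (adj : rel V) r0 :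
  atomic (graph_network adj r0).
Proof.
move=> u v uv.
have ne : [set if adj u v then PO else r0] !=set0 by eexists.
by exists (Constraint u v ne); split; [|eexists|left].
Qed.

Lemma graph_network_over (V : eqType) (adj : rel V) r0 :
  network_over (graph_network adj r0) [set r0; PO].
Proof.
by move=> c [_ ->] r ->; case: ifP => _; [right | left].
Qed.

Lemma natr_near_eq (R : realDomainType) (a b : nat) :
  a%:R < b%:R + 1 :> R -> b%:R < a%:R + 1 :> R -> a = b.
Proof. by rewrite !natr1 !ltr_nat !ltnS => ab ba; apply/eqP; rewrite eqn_leq ab. Qed.

(** Near a common interior point, [closure B] contains a point of [A]; the open set [A] around that
    point then meets [B]. *)
Lemma disjoint_interior_closure (T : topologicalType) (A B : set T) :
  open A -> open B -> A `&` B = set0 -> (closure A)^° `&` (closure B)^° = set0.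
Proof.
move=> oA oB AB; apply/seteqP; split=> // x [xA xB].
have [y [yA yB]] := interior_subset xA _ xB.
have [z zAB] := yB _ (open_nbhs_nbhs (conj oA yA)).
by rewrite setIC AB in zAB.
Qed.

(** * Realisation by intervals on the line *)

Section Consistency.
Variables (R : realType) (V : countType) (adj : rel V) (ec : bool).
Hypothesis adj_sym : symmetric adj.

(* Every vertex and every ordered pair of vertices has a block of two
   consecutive unit intervals, distinguished by a boolean; [owns v c r] says
   that the region of [v] contains the interval [r] of the block [c].  Only
   non-adjacent pairs with [ec] use both intervals of their block. *)
Definition owns (v : V) (c : V + V * V) (r : bool) : bool :=
  match c with
  | inl w => (v == w) && ~~ r
  | inr (a, b) => if adj a b then ((v == a) || (v == b)) && ~~ r
                  else ec && (v == if r then b else a)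
  end.

Lemma owns_shared u v c r : u <> v -> owns u c r -> owns v c r -> adj u v.
Proof.
case: c => [w|[a b]] /= uv.
  by move=> /andP[/eqP uw _] /andP[/eqP vw _]; case: uv; rewrite uw vw.
case: ifP => ab.
  move=> /andP[+ _] /andP[+ _] => /orP[]/eqP eu /orP[]/eqP ev; subst=> //.
  by rewrite adj_sym.
by move=> /andP[_ /eqP eu] /andP[_ /eqP ev]; case: uv; rewrite eu ev.
Qed.

(* The factor 4 keeps the closures of distinct blocks disjoint. *)
Definition slot (c : V + V * V) (r : bool) : nat := (4 * pickle c + r)%N.

Lemma slot_inj c c' r r' : slot c r = slot c' r' -> c = c' /\ r = r'.
Proof.
rewrite /slot => e; have p : pickle c = pickle c' by case: r e; case: r'; lia.
split; first exact: (pcan_inj pickleK p).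
by case: r e; case: r' => //; lia.
Qed.

(** The intervals are open so that the closure, used as the region of [v], is regular closed. *)
Definition slots (v : V) : set 'rV[R]_1 :=
  [set x | exists c r, owns v c r /\ (slot c r)%:R < x 0 0 < (slot c r)%:R + 1].

Lemma slots_open v : open (slots v).
Proof.
rewrite openE => x [c [r [vcr /andP[lt1 lt2]]]].
pose f (y : 'rV[R]_1) := y 0 0.
have cf : {for x, continuous f} by exact: coord_continuous.
have n1 : \forall y \near x, (slot c r)%:R < f y by exact: (cvgr_gt _ cf).
have n2 : \forall y \near x, f y < (slot c r)%:R + 1 by exact: (cvgr_lt _ cf).
rewrite /interior /=; near=> y; exists c, r; split=> //; apply/andP; split; near: y; done.
Unshelve. all: by end_near. Qed.

(** A margin of 1/2 is enough: interval ends are integers, so it still identifies the interval of a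
    midpoint and keeps distinct blocks apart. *)
Lemma closure_slots_near v (x : 'rV[R]_1) : closure (slots v) x ->
  exists c r, owns v c r /\ (slot c r)%:R - 2^-1 < x 0 0 < (slot c r)%:R + 3 / 2.
Proof.
have h0 : (0 : R) < 2^-1 by rewrite invr_gt0.
move=> /(_ _ (nbhsx_ballx x 2^-1 h0)) [y [[c [r [vcr /andP[lt1 lt2]]]] [_ xy]]].
exists c, r; split=> //; have := xy 0 0; rewrite /ball /= ltr_norml.
by move=> /andP[]; lra.
Qed.

Lemma closure_slots v c r (x : 'rV[R]_1) : owns v c r ->
  (slot c r)%:R <= x 0 0 <= (slot c r)%:R + 1 -> closure (slots v) x.
Proof.
move=> vcr /andP[le1 le2] B /nbhs_ballP[e /= e0 eB].
pose t := Num.min e 1 / 2.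
have t0 : 0 < t by rewrite /t divr_gt0 // lt_min e0 /=.
have te : t < e.
  rewrite /t; have : Num.min e 1 <= e by rewrite ge_min lexx.
  by lra.
have t1 : t < 1.
  rewrite /t; have : Num.min e 1 <= 1 by rewrite ge_min lexx orbT.
  by lra.
pose d := x 0 0 - (slot c r)%:R.
have d0 : 0 <= d by rewrite /d; lra.
have d1 : d <= 1 by rewrite /d; lra.
have td0 : 0 <= t * d by apply: mulr_ge0 => //; exact: ltW.
have td1 : t * d <= d by apply: ler_piMl => //; exact: ltW.
have td2 : t * d <= t by apply: ler_piMr => //; exact: ltW.
have td3 : (1 - t) * d <= 1 - t by apply: ler_piMr => //; lra.
(* The point of [x] moved by the fraction [t] of its way to the midpoint, hence strictly inside the
   interval and within [e] of [x]. *)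
exists (const_mx ((slot c r)%:R + d - t * d + t / 2)); split.
  by exists c, r; split=> //; rewrite mxE; apply/andP; split; lra.
apply: eB; split=> // i j; rewrite mxE /ball /= !ord1 ltr_norml.
have -> : x 0 0 = (slot c r)%:R + d by rewrite /d; lra.
by apply/andP; split; lra.
Qed.

Lemma slots_disjoint u v : u <> v -> ~~ adj u v -> slots u `&` slots v = set0.
Proof.
move=> uv nadj; apply/seteqP; split=> // x [[c [r [uc /andP[l1 l2]]]]].
move=> [c' [r' [vc /andP[l3 l4]]]]; case/negP: nadj.
have e : slot c r = slot c' r'.
  by apply: (@natr_near_eq R); lra.
have [ce re] := slot_inj e; subst.
exact: owns_shared uc vc.
Qed.

Lemma slots_region v : region (closure (slots v)).
Proof.
split; last exact/closure_open_regclosed/slots_open.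
exists (const_mx (slot (inl v) false)%:R); apply: (@closure_slots _ (inl v) false).
  by rewrite /= eqxx.
by rewrite mxE lexx lerDl ler01.
Qed.

Lemma slots_not_sub u v : u <> v -> ~ closure (slots u) `<=` closure (slots v).
Proof.
move=> uv sub.
(* The midpoint of the private interval of [u]. *)
have : closure (slots u) (const_mx ((slot (inl u) false)%:R + 2^-1)).
  apply: (@closure_slots _ (inl u) false); first by rewrite /= eqxx.
  by rewrite mxE; apply/andP; split; lra.
move=> /sub/closure_slots_near[c [r [vc]]]; rewrite mxE => /andP[l1 l2].
have e : slot (inl u) false = slot c r.
  by apply: (@natr_near_eq R); lra.
have [ce re] := slot_inj e; subst.
by move: vc; rewrite /= => /andP[/eqP vu _]; case: uv.
Qed.

Lemma slots_PO u v : u <> v -> adj u v ->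
  rcc8_holds PO (closure (slots u)) (closure (slots v)).
Proof.
move=> uv auv; split; [|exact: slots_not_sub|by apply: slots_not_sub => /esym].
exists (const_mx ((slot (inr (u, v)) false)%:R + 2^-1)).
have sub w : slots w `<=` (closure (slots w))^°.
  by rewrite -open_subsetE; [exact: subset_closure | exact: slots_open].
by split; apply: sub; exists (inr (u, v)), false; rewrite /= auv eqxx ?orbT mxE;
  split=> //; apply/andP; split; lra.
Qed.

Lemma slots_not_PO u v : u <> v -> ~~ adj u v ->
  rcc8_holds (if ec then EC else DC) (closure (slots u)) (closure (slots v)).
Proof.
move=> uv nuv; case: ifP => ecE /=.
  split.
    (* The common end of the two consecutive intervals, one owned by [u] and the next by [v]. *)
    exists (const_mx (slot (inr (u, v)) true)%:R); split.
      apply: (@closure_slots _ (inr (u, v)) false).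
        by rewrite /= (negPf nuv) ecE eqxx.
      have -> : (slot (inr (u, v)) true)%:R = (slot (inr (u, v)) false)%:R + 1 :> R.
        by rewrite natr1 /slot addn0 addn1.
      by rewrite mxE; apply/andP; split; lra.
    apply: (@closure_slots _ (inr (u, v)) true).
      by rewrite /= (negPf nuv) ecE eqxx.
    by rewrite mxE; apply/andP; split; lra.
  exact: (disjoint_interior_closure (@slots_open u) (@slots_open v)
    (slots_disjoint uv nuv)).
apply/seteqP; split=> // x [/closure_slots_near[c [r [uc /andP[l1 l2]]]]].
move=> /closure_slots_near[c' [r' [vc /andP[l3 l4]]]]; case/negP: nuv.
(* Without [ec] all intervals used start at multiples of 4, so two starts less than 2 apart
   coincide. *)
have left w d s : owns w d s -> s = false.
  by case: d => [?|[a b]] /=; rewrite ?ecE; last (case: ifP => // _);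
    by move=> /andP[_ /negbTE].
have [r0 r'0] := (left _ _ _ uc, left _ _ _ vc); subst r r'.
have c2 : (slot c false < slot c' false + 2)%N.
  by rewrite -(ltr_nat R) natrD; lra.
have c2' : (slot c' false < slot c false + 2)%N.
  by rewrite -(ltr_nat R) natrD; lra.
have /slot_inj[cc' _] : slot c false = slot c' false.
  by move: c2 c2'; rewrite /slot /=; lia.
by subst c'; exact: owns_shared uc vc.
Qed.

Lemma graph_network_consistent :
  consistent R (graph_network adj (if ec then EC else DC)).
Proof.
exists 1; split=> //; exists (fun v => closure (slots v)); split=> [v|c [uv ->]].
  exact: slots_region.
eexists; first by [].
by have [auv|nauv] := boolP (adj _ _); [exact: slots_PO | exact: slots_not_PO].
Qed.

End Consistency.

(** * From convex solutions to drawings *)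

Lemma convex_interior (R : realType) (V : normedModType R) (A : set V) :
  convex_set (A : set (convex_lmodType V)) ->
  forall x y t, 0 <= t <= 1 -> A^° x -> A^° y -> A^° ((1 - t) *: x + t *: y).
Proof.
move=> cA x y t /andP[t0]; rewrite le_eqVlt => /orP[/eqP->|t1] Ax Ay.
  by rewrite subrr scale0r add0r scale1r.
have t1n : 1 - t != 0 by rewrite gt_eqF // subr_gt0.
(* The inverse of [z -> (1 - t) *: z + t *: y]: for [z] near [w], [f z] is near [x], hence in [A],
   and [z] lies on the segment from [f z] to [y]. *)
pose f (z : V) := (1 - t)^-1 *: (z - t *: y).
set w := _ + _.
have fw : f w = x by rewrite /f /w addrK scalerA mulVf // scale1r.
have cf : f @ w --> x.
  have cg : (fun z : V => z - t *: y) @ w --> w - t *: y.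
    by apply: cvgB; [exact: cvg_id | exact: cvg_cst].
  by rewrite -fw; exact: (@cvgZl_tmp _ _ _ _ _ (1 - t)^-1 _ _ cg).
have near_w : \forall z \near w, A (f z) by exact: cf.
rewrite /interior /=; apply: filterS near_w => z Afz.
have u0 : 0 <= 1 - t by lra.
have u1 : 1 - t <= 1 by lra.
have := cA (f z) y (Itv01 u0 u1) (mem_set Afz) (mem_set (interior_subset Ay)).
move=> /set_mem; congr A.
by rewrite /conv /= /f /unstable.onem subKr scalerA mulfV // scale1r subrK.
Qed.

Definition incident (x y : 'I_27 + bool * {set 'I_27}) : bool :=
  match x, y with
  | inl i, inr d | inr d, inl i => i \in d.2
  | _, _ => false
  end.

Lemma incident_sym : symmetric incident.
Proof. by case=> [?|?] [?|?]. Qed.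

(** Passing to interiors treats both networks at once: they meet under [PO], are disjoint under [EC]
    and [DC], and inherit convexity. *)
Lemma incident_no_convex_solution (R : realType) (ec : bool) :
  ~ exists S : 'I_27 + bool * {set 'I_27} -> set 'rV[R]_2,
      convex_solution (graph_network incident (if ec then EC else DC)) S.
Proof.
move=> [S [[Sreg Ssol] Sconv]].
pose vec (x y : R) : 'rV[R]_2 := \row_j (if j == 0 then x else y).
pose P v (x y : R) := (S v)^° (vec x y).
have Pconvex v : pconvex (P v).
  move=> x y x' y' t t01 h h'; rewrite /P.
  have -> : vec ((1 - t) * x + t * x') ((1 - t) * y + t * y') =
      (1 - t) *: vec x y + t *: vec x' y'.
    by apply/rowP => j; rewrite !mxE; case: ifP.
  exact: (convex_interior (Sconv v)).
have rel u v : u <> v ->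
    rcc8_holds (if incident u v then PO else if ec then EC else DC) (S u) (S v).
  move=> uv.
  have ne : [set if incident u v then PO else if ec then EC else DC] !=set0 by eexists.
  by have [_ /= ->] := Ssol (Constraint u v ne) (conj uv erefl).
have Papart u v : u <> v -> ~~ incident u v -> apart (P u) (P v).
  move=> uv nuv x y; rewrite /P => Pu Pv.
  have := rel _ _ uv; rewrite (negPf nuv); case: ifP => _ /=.
    by move=> [_ disj]; have : ((S u)^° `&` (S v)^°) (vec x y) by []; rewrite disj.
  move=> disj.
  have : (S u `&` S v) (vec x y) by split; exact: interior_subset.
  by rewrite disj.
apply: (@no_drawing R (fun i => P (inl i)) (fun d => P (inr d))).
split=> [i|d|i j ij|d d' dd'|i d] //.
- by apply: Papart => // -[] /eqP; rewrite (negPf ij).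
- by apply: Papart => // -[] /eqP; rewrite (negPf dd').
case: ifPn => id; last exact: Papart.
have := rel (inl i) (inr d) _; rewrite /= id => -[//|[z [zi zd]] _ _].
exists (z 0 0), (z 0 1); rewrite /P.
have -> : vec (z 0 0) (z 0 1) = z.
  apply/rowP => j; rewrite mxE; case: eqP => [->//|/eqP j0].
  by congr (z 0 _); apply/val_inj; case: j j0 => [[|[|]]].
by [].
Qed.

Theorem corollary8 (R : realType) :
  (exists (V : finType) (N : network V),
    [/\ consistent R N, atomic N, network_over N [set DC; PO] &
        ~ exists S : V -> set 'rV[R]_2, convex_solution N S]) /\
  (exists (V : finType) (N : network V),
    [/\ consistent R N, atomic N, network_over N [set EC; PO] &
        ~ exists S : V -> set 'rV[R]_2, convex_solution N S]).
Proof.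
split.
- exists ('I_27 + bool * {set 'I_27})%type, (graph_network incident DC); split.
  + exact: (graph_network_consistent R false incident_sym).
  + exact: graph_network_atomic.
  + exact: graph_network_over.
  + exact: (@incident_no_convex_solution R false).
- exists ('I_27 + bool * {set 'I_27})%type, (graph_network incident EC); split.
  + exact: (graph_network_consistent R true incident_sym).
  + exact: graph_network_atomic.
  + exact: graph_network_over.
  + exact: (@incident_no_convex_solution R true).
Qed.
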